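(* Let $\Theta=(J_3,J_5,\alpha,\beta)$ be a Jacobi-type pencil, let $\{p_n(\lambda)\}_{n=0}^\infty$ be the associated polynomials of $\Theta$, and let $\mathcal{A}=\mathcal{A}_\sigma$ be the model representation in $L^2_\sigma$ of the associated operator of $\Theta$. Let $N$ be a positive integer. The polynomials $\{p_n(\lambda)\}_{n=0}^\infty$ satisfy a recurrence relation of the form $$\sum_{j=1}^N\bigl(\overline{\alpha_{k-j,j}}\,p_{k-j}(\lambda)+\alpha_{k,j}\,p_{k+j}(\lambda)\bigr)+\alpha_{k,0}\,p_k(\lambda)=\lambda^Np_k(\lambda),\qquad k\in\mathbb{Z}_+,$$ with some complex coefficients $\alpha_{m,n}$ ($m\in\mathbb{Z}_+$, $n=0,1,\ldots,N$) such that $\alpha_{m,N}>0$ and $\alpha_{m,0}\in\mathbb{R}$ (where $\alpha_{m,n}$ and $p_k$ with negative indices $m$, $k$ are zero) if and only if $\mathcal{A}^N$ is a symmetric operator in $L^2_\sigma$.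
   Context: $\mathbb{Z}_+$ denotes the non-negative integers. $l_2$ is the Hilbert space of square-summable complex sequences indexed by $\mathbb{Z}_+$, $\vec e_n$ its standard basis vectors ($\vec e_k:=0$ for $k<0$), and $l_{2,fin}$ the subspace of finitely supported vectors. A Jacobi-type pencil is a tuple $\Theta=(J_3,J_5,\alpha,\beta)$, where $\alpha>0$, $\beta\in\mathbb{R}$, $J_3$ is a semi-infinite real symmetric tridiagonal (Jacobi) matrix, rows and columns indexed by $\mathbb{Z}_+$, with real diagonal entries and positive entries $(J_3)_{k,k+1}=(J_3)_{k+1,k}$, and $J_5$ is a semi-infinite real symmetric five-diagonal matrix with positive entries $(J_5)_{k,k+2}=(J_5)_{k+2,k}$, $k\in\mathbb{Z}_+$. The associated polynomials of $\Theta$ are the unique system of polynomials $\{p_n(\lambda)\}_{n=0}^\infty$ with $p_0(\lambda)=1$, $p_1(\lambda)=\alpha\lambda+\beta$ and $(J_5-\lambda J_3)(p_0(\lambda),p_1(\lambda),p_2(\lambda),\ldots)^T=0$; each $p_n$ is a real polynomial of degree $n$ with positive leading coefficient. Associated operator of $\Theta$: the vectors $\vec e_0$ and $J_3\vec e_n$ ($n\in\mathbb{Z}_+$) form a linear basis of $l_{2,fin}$; the associated operator $A$, with domain $l_{2,fin}$, is the linear operator defined by $$A\Bigl(\zeta\vec e_0+\sum_{n}\xi_nJ_3\vec e_n\Bigr)=\frac{\zeta}{\alpha}(\vec e_1-\beta\vec e_0)+\sum_n\xi_nJ_5\vec e_n,\qquad \zeta,\xi_n\in\mathbb{C}$$ (finite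 sums). Model representation: let $\{r_n(\lambda)\}_{n=0}^\infty$, $r_0=1$, be the polynomials with $J_3\vec r(\lambda)=\lambda\vec r(\lambda)$, $\vec r=(r_0,r_1,\ldots)^T$, and let $\sigma$ be an (arbitrary) non-negative finite Borel measure on $\mathbb{R}$ with respect to which $\{r_n\}$ are orthonormal (it exists by Favard's theorem). Let $\mathcal{P}\subset L^2_\sigma$ be the set of (classes of) complex polynomials and $U:l_{2,fin}\to\mathcal{P}$ the linear bijection with $U\vec e_n=[r_n]$. Then $\mathcal{A}=\mathcal{A}_\sigma=UAU^{-1}$, a linear operator in $L^2_\sigma$ with domain $\mathcal{P}$ mapping $\mathcal{P}$ into $\mathcal{P}$. Symmetric means $(\mathcal{A}^Nf,g)_{L^2_\sigma}=(f,\mathcal{A}^Ng)_{L^2_\sigma}$ for all $f,g\in\mathcal{P}$. *)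

(* Defs.v *)
From HB Require Import structures.
From mathcomp Require Import all_boot all_order all_algebra.
From mathcomp Require Import all_classical all_reals all_analysis.
From mathcomp Require Import measurable_realfun.
From mathcomp Require Import complex.

Set Implicit Arguments.
Unset Strict Implicit.
Unset Printing Implicit Defensive.

Import Order.TTheory GRing.Theory Num.Theory.
Import numFieldNormedType.Exports.

Local Open Scope classical_set_scope.
Local Open Scope ring_scope.
Local Open Scope complex_scope.

Local Notation Re := complex.Re.
Local Notation Im := complex.Im.

(* Semi-infinite matrices are functions [nat -> nat -> R] (row, column). *)

Definition symmetric_matrix (R : realType) (J : nat -> nat -> R) :=
  forall i j, J i j = J j i.

(* [w = 1]: tridiagonal; [w = 2]: five-diagonal. *)
Definition banded (R : realType) (w : nat) (J : nat -> nat -> R) :=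
  forall i j, (w + i < j)%N || (w + j < i)%N -> J i j = 0.

Record jacobi_pencil (R : realType) := JacobiPencil {
  J3 : nat -> nat -> R;
  J5 : nat -> nat -> R;
  alpha : R;
  beta : R;
  J3_sym : symmetric_matrix J3;
  J3_band : banded 1 J3;
  J3_gt0 : forall k, 0 < J3 k k.+1;
  J5_sym : symmetric_matrix J5;
  J5_band : banded 2 J5;
  J5_gt0 : forall k, 0 < J5 k k.+2;
  alpha_gt0 : 0 < alpha }.

(* Row [k] of the product of [J] with an infinite column of polynomials. For
   [banded 1] and [banded 2] matrices, row [k] vanishes beyond column [k + 2],
   so that the sum below is the full (infinite) one. *)
Definition mulmx_polys (R : realType) (J : nat -> nat -> R)
    (v : nat -> {poly R}) (k : nat) : {poly R} :=
  \sum_(j < k.+3) J k j *: v j.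

Definition associated_polynomials (R : realType) (T : jacobi_pencil R)
    (p : nat -> {poly R}) :=
  [/\ p 0%N = 1,
      p 1%N = alpha T *: 'X + (beta T)%:P &
      forall k, mulmx_polys (J5 T) p k - 'X * mulmx_polys (J3 T) p k = 0].

Definition jacobi_polynomials (R : realType) (T : jacobi_pencil R)
    (r : nat -> {poly R}) :=
  r 0%N = 1 /\ forall k, mulmx_polys (J3 T) r k = 'X * r k.

Definition complex_poly (R : realType) (q : {poly R}) : {poly R[i]} :=
  map_poly (real_complex R) q.

Definition finite_support (R : realType) : {pred nat -> R[i]} :=
  mem [set u : nat -> R[i] | finite_set [set n | u n != 0]].

Lemma finite_support_submod (R : realType) :
  submod_closed (@finite_support R).
Proof.
split=> [|a u v /[!inE] fu fv].
  by rewrite inE; apply: (sub_finite_set _ (@finite_set0 nat)) => n /=; rewrite eqxx.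
apply: (@sub_finite_set _ _ ([set n | u n != 0] `|` [set n | v n != 0])); last first.
  by rewrite finite_setU.
move=> n /= uvn; case: (eqVneq (u n) 0) => [un0|]; last by left.
by right; apply: contraNneq uvn => vn0; rewrite /GRing.add /= /GRing.scale /= un0 vn0 scaler0 addr0.
Qed.

HB.instance Definition _ (R : realType) :=
  GRing.isSubmodClosed.Build R[i] (nat -> R[i]) (@finite_support R)
    (finite_support_submod R).

Record l2fin (R : realType) := L2fin {
  l2coef :> nat -> R[i];
  l2fin_finite_support : l2coef \in @finite_support R }.

HB.instance Definition _ (R : realType) := [isSub for @l2coef R].
HB.instance Definition _ (R : realType) := [Choice of l2fin R by <:].
HB.instance Definition _ (R : realType) :=
  [SubChoice_isSubLmodule of l2fin R by <:].

Lemma column_finite_support (R : realType) (w : nat) (J : nat -> nat -> R)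
    (n : nat) :
  banded w J -> (fun k => (J k n)%:C) \in @finite_support R.
Proof.
move=> bJ; rewrite inE; apply: (sub_finite_set _ (finite_II (w + n).+1)) => k /=.
rewrite ltnS leqNgt; apply: contraNN => kn.
by rewrite bJ ?kn ?orbT.
Qed.

Lemma basis_finite_support (R : realType) (n : nat) :
  (fun k => (k == n)%:R) \in @finite_support R.
Proof.
rewrite inE; apply: (sub_finite_set _ (finite_set1 n)) => k /=.
by case: (eqVneq k n) => //= _; rewrite eqxx.
Qed.

Definition l2e (R : realType) (n : nat) : l2fin R :=
  L2fin (basis_finite_support R n).

(* [J3e T n] and [J5e T n] are J3 e_n and J5 e_n, the [n]-th columns. *)
Definition J3e (R : realType) (T : jacobi_pencil R) (n : nat) : l2fin R :=
  L2fin (column_finite_support n (J3_band T)).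

Definition J5e (R : realType) (T : jacobi_pencil R) (n : nat) : l2fin R :=
  L2fin (column_finite_support n (J5_band T)).

Definition associated_operator (R : realType) (T : jacobi_pencil R)
    (A : l2fin R -> l2fin R) :=
  forall (zeta : R[i]) (m : nat) (xi : nat -> R[i]),
    A (zeta *: l2e R 0 + \sum_(n < m) xi n *: J3e T n) =
    (zeta / (alpha T)%:C) *: (l2e R 1 - (beta T)%:C *: l2e R 0)
    + \sum_(n < m) xi n *: J5e T n.

(* Borel sets of the complex plane, transported from R * R. *)
Section complex_borel.
Variable R : realType.

Definition complex_borel : set (set R[i]) :=
  [set A | measurable [set xy : measurableTypeR R * measurableTypeR R |
                        A (xy.1 +i* xy.2)]].

Lemma complex_borel0 : complex_borel set0.
Proof. exact: measurable0. Qed.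

Lemma complex_borelC A : complex_borel A -> complex_borel (~` A).
Proof. exact: measurableC. Qed.

Lemma complex_borel_bigcup (F : (set R[i])^nat) :
  (forall k, complex_borel (F k)) -> complex_borel (\bigcup_k F k).
Proof. exact: bigcupT_measurable. Qed.

End complex_borel.

HB.instance Definition _ (R : realType) := isPointed.Build R[i] 0.
HB.instance Definition _ (R : realType) :=
  isMeasurable.Build default_measure_display R[i]
    (@complex_borel0 R) (@complex_borelC R) (@complex_borel_bigcup R).

Definition poly_fun (R : realType) (q : {poly R[i]}) (x : measurableTypeR R) :
  R[i] := q.[x%:C].

Lemma measurable_complex_fun (R : realType) (f : measurableTypeR R -> R[i]) :
  measurable_fun setT (fun x => Re (f x) : measurableTypeR R) ->
  measurable_fun setT (fun x => Im (f x) : measurableTypeR R) ->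
  measurable_fun setT f.
Proof.
move=> mRe mIm _ A mA.
have := measurable_fun_pair mRe mIm measurableT mA.
by congr measurable; congr (_ `&` _); apply/seteqP; split=> x /=; case: (f x).
Qed.

Lemma measurable_poly_fun (R : realType) (q : {poly R[i]}) :
  measurable_fun setT (poly_fun q).
Proof.
suff [mRe mIm] : measurable_fun setT (fun x => Re (poly_fun q x)) /\
    measurable_fun setT (fun x => Im (poly_fun q x)).
  exact: measurable_complex_fun.
elim/poly_ind: q => [|q c [mRe mIm]].
  by split; under eq_fun do rewrite /poly_fun horner0 /=; exact: measurable_cst.
have E x : poly_fun (q * 'X + c%:P) x
    = (Re (poly_fun q x) * x + Re c) +i* (Im (poly_fun q x) * x + Im c).
  rewrite /poly_fun hornerMXaddC; case: q.[_] => a b; case: c => u v.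
  by apply/eqP; rewrite eq_complex /= !mulr0 subr0 add0r !eqxx.
split.
- under eq_fun do rewrite E /=.
  by apply: measurable_funD => //; apply: measurable_funM.
- under eq_fun do rewrite E /=.
  by apply: measurable_funD => //; apply: measurable_funM.
Qed.

HB.instance Definition _ (R : realType) (q : {poly R[i]}) :=
  @isMeasurableFun.Build _ _ (measurableTypeR R) R[i] (poly_fun q)
    (measurable_poly_fun q).

Section model.
Variables (R : realType).
Variable sigma : {finite_measure set (measurableTypeR R) -> \bar R}.

(* Classes of sigma-a.e. equal measurable complex functions on the line. *)
Notation L0 := {mfun_ sigma, measurableTypeR R >-> R[i]}.

Definition L2 : set L0 :=
  [set f | (\int[sigma]_x (Normc.normc (f x) ^+ 2)%:E < +oo)%E].

Definition L2inner (f g : L0) : R[i] :=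
  (\int[sigma]_x Re (f x * (g x)^*)) +i* (\int[sigma]_x Im (f x * (g x)^*)).

Definition poly_class (q : {poly R[i]}) : L0 := (\pi_L0 (poly_fun q))%qT.

Definition poly_classes : set L0 := range poly_class.

Definition orthonormal_polynomials (r : nat -> {poly R}) :=
  (forall n, L2 (poly_class (complex_poly (r n)))) /\
  (forall m n, L2inner (poly_class (complex_poly (r m)))
                       (poly_class (complex_poly (r n))) = (m == n)%:R).

(* The linear map sending [l2e n] to the class of [r n]; the sum is over the
   (finite) support of [u]. *)
Definition model_map (r : nat -> {poly R}) (u : l2fin R) : L0 :=
  poly_class (\sum_(n \in [set n | u n != 0]) u n *: complex_poly (r n)).

(* [model_map r] is injective when the [r n] are orthonormal, so that [xget]
   returns the unique preimage of [f] if [f] is in [poly_classes], which is the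
   domain of the operator; values outside of [poly_classes] are junk. *)
Definition model_representation (r : nat -> {poly R})
    (A : l2fin R -> l2fin R) (f : L0) : L0 :=
  model_map r (A (xget 0 [set u | model_map r u = f])).

Definition symmetric_on_polynomials (B : L0 -> L0) :=
  forall f g, poly_classes f -> poly_classes g ->
    L2inner (B f) g = L2inner f (B g).

End model.

Arguments poly_class {R} sigma q.
Arguments model_map {R} sigma r u.
Arguments model_representation {R} sigma r A f.

(* Main.v *)
Require Import Defs.
From HB Require Import structures.
From mathcomp Require Import all_boot all_order all_algebra.
From mathcomp Require Import all_classical all_reals all_analysis.
From mathcomp Require Import measurable_realfun zify lra.
From mathcomp Require Import complex.

Set Implicit Arguments.
Unset Strict Implicit.
Unset Printing Implicit Defensive.

Import Order.TTheory GRing.Theory Num.Theory.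
Import numFieldNormedType.Exports.
Local Open Scope ring_scope.
Local Open Scope complex_scope.

(** Let [p_n] be the associated polynomials. The linear bijection sending [e_n]
    to [p_n] turns [A] into multiplication by the variable: [J3 e_n] goes to
    row [n] of [J3 p] and [J5 e_n] to row [n] of [J5 p], which is [X] times the
    former. Hence [X^N p_k] is the combination of the [p_l] whose coefficients
    form column [k] of the matrix of [A^N]. By degrees this matrix vanishes
    below its [N]-th subdiagonal and is positive on it, so the recurrence says
    exactly that the matrix is Hermitian. On the other side, [e_n |-> r_n] is an
    isometry onto the polynomials in [L^2(sigma)], so being Hermitian is the
    symmetry of the [N]-th power of the model operator. *)

(** * Polynomial families graded by degree *)

Lemma coef_size_neq0 (K : nzRingType) (f : {poly K}) (n : nat) :
  size f = n.+1 -> f`_n != 0.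
Proof.
move=> sf; have : lead_coef f != 0 by rewrite lead_coef_eq0 -size_poly_eq0 sf.
by rewrite lead_coefE sf.
Qed.

Lemma polys_free (F : fieldType) (q : nat -> {poly F}) (c : nat -> F) (m : nat) :
  (forall n, size (q n) = n.+1) -> \sum_(n < m) c n *: q n = 0 ->
  forall n, (n < m)%N -> c n = 0.
Proof.
move=> sq; elim: m => // m IH; rewrite big_ord_recr /= => sum0.
have cm : c m = 0.
  have /(congr1 (fun f : {poly F} => f`_m)) := sum0.
  rewrite coefD coefZ coef0 coef_sum big1 ?add0r => [/eqP|i _]; last first.
    by rewrite coefZ nth_default ?mulr0// sq.
  by rewrite mulf_eq0 (negbTE (coef_size_neq0 (sq m))) orbF => /eqP.
move: sum0; rewrite cm scale0r addr0 => sum0 n.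
by rewrite ltnS leq_eqVlt => /predU1P[->//|]; exact: IH.
Qed.

(** A multiple of [q m] removes the coefficient of [X^m], which lowers the size bound by one. *)
Lemma polys_span (F : fieldType) (q : nat -> {poly F}) (m : nat) (f : {poly F}) :
  (forall n, size (q n) = n.+1) -> (size f <= m)%N ->
  exists c : nat -> F, f = \sum_(n < m) c n *: q n.
Proof.
move=> sq; elim: m f => [f|m IH f sf].
  by rewrite leqn0 size_poly_eq0 => /eqP ->; exists (fun=> 0); rewrite big_ord0.
have qm := coef_size_neq0 (sq m).
have [|c fc] := IH (f - (f`_m / (q m)`_m) *: q m).
  apply/leq_sizeP => j; rewrite leq_eqVlt => /predU1P[<-|mj].
    by rewrite coefB coefZ divfK ?subrr.
  rewrite coefB coefZ (nth_default _ (leq_trans sf mj)) sub0r.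
  by rewrite [(q m)`_j]nth_default ?sq// mulr0 oppr0.
exists (fun n => if n == m then f`_m / (q m)`_m else c n).
rewrite big_ord_recr /= eqxx -[LHS](subrK ((f`_m / (q m)`_m) *: q m)) fc.
by congr (_ + _); apply: eq_bigr => i _; rewrite ltn_eqF.
Qed.

(** Groups the terms of a band around [k] by their distance to [k], which is the shape of the
    recurrence. The test [j <= k] encodes the convention that terms of negative index vanish. *)
Lemma big_band_split (V : zmodType) (F : nat -> V) (k N : nat) :
  (forall l, (l + N < k)%N -> F l = 0) ->
  \sum_(l < (k + N).+1) F l =
  \sum_(1 <= j < N.+1) ((if (j <= k)%N then F (k - j)%N else 0) + F (k + j)%N)
  + F k.
Proof.
move=> F0; rewrite -(big_mkord xpredT F) (big_cat_nat (n := k))//=; last first.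
  by rewrite leqW// leq_addr.
rewrite big_split -addrA; congr (_ + _).
  rewrite -big_mkcond big_nat_rev big_add1 /=.
  (* Neither of [k] and [N] bounds the other, so both sums are extended to [k + N]; the terms with
     [N <= i < k] vanish by [F0]. *)
  rewrite (big_nat_widen _ _ (k + N)) ?leq_addr//.
  rewrite [RHS](big_nat_widen _ _ (k + N)) ?leq_addl//.
  rewrite big_mkcond [RHS]big_mkcond; apply: eq_bigr => i _ /=.
  rewrite add0n andbC; case: ifP => //= ik; last by rewrite andbF.
  by case: ltnP => // Ni; apply: F0; rewrite -[ltnRHS](subnK ik) ltn_add2l.
rewrite big_ltn ?ltnS ?leq_addr// addrC; congr (_ + _).
rewrite -add1n big_addn -addnS addKn.
by apply: eq_bigr => i _; rewrite addnC.
Qed.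

(** * Coordinates of finitely supported vectors *)

Arguments l2coef : simpl never.

Lemma l2fin_bound (R : realType) (u : l2fin R) :
  exists m, forall n, (m <= n)%N -> u n = 0.
Proof.
have := l2fin_finite_support u; rewrite inE /= => fu.
have /finite_seqP[s us] := fu.
exists (\max_(i <- s) i).+1 => n mn; apply/eqP/negPn/negP => un0.
have sn : n \in s by have : [set` s]%classic n by rewrite -us.
by have := leq_trans mn (leq_bigmax_seq (F := id) n sn isT); rewrite ltnn.
Qed.

Lemma l2fin_eqP (R : realType) (u v : l2fin R) : (forall n, u n = v n) -> u = v.
Proof. by move=> uv; apply/val_inj/funext. Qed.

Lemma l2finD (R : realType) (u v : l2fin R) (n : nat) : (u + v) n = u n + v n.
Proof. by []. Qed.

Lemma l2finZ (R : realType) (a : R[i]) (u : l2fin R) (n : nat) :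
  (a *: u) n = a * u n.
Proof. by []. Qed.

Lemma l2eE (R : realType) (n k : nat) : l2e R n k = (k == n)%:R.
Proof. by []. Qed.

Lemma l2fin_sumE (R : realType) (I : Type) (s : seq I) (P : pred I)
    (F : I -> l2fin R) (n : nat) :
  (\sum_(i <- s | P i) F i) n = \sum_(i <- s | P i) F i n.
Proof. exact: (big_morph (fun u : l2fin R => u n)). Qed.

Lemma l2fin_sum_l2e (R : realType) (m : nat) (c : nat -> R[i]) (k : nat) :
  (\sum_(n < m) c n *: l2e R n) k = if (k < m)%N then c k else 0.
Proof.
rewrite l2fin_sumE; case: ltnP => [km|mk].
  rewrite (bigD1 (Ordinal km)) //= l2finZ l2eE eqxx mulr1 big1 ?addr0// => i.
  by rewrite l2finZ l2eE -val_eqE /= eq_sym => /negbTE ->; rewrite mulr0.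
rewrite big1 // => i _.
by rewrite l2finZ l2eE gtn_eqF ?mulr0// (leq_trans (ltn_ord i)).
Qed.

(** * Linear maps from finitely supported vectors to polynomials *)

Section comb.
Variable (R : realType).
Implicit Types (q : nat -> {poly R[i]}) (u v : l2fin R).

(* The linear map sending [l2e n] to [q n]; [model_map] is its class for [q = r]. *)
Definition comb q u : {poly R[i]} :=
  \sum_(n \in [set n | u n != 0]) u n *: q n.

Lemma comb_bound q u m : (forall n, (m <= n)%N -> u n = 0) ->
  comb q u = \sum_(n < m) u n *: q n.
Proof.
move=> um; rewrite (fsbig_ord _ m (fun n => u n *: q n)); apply: fsbig_widen => n /=.
  by rewrite ltnNge; apply: contraNN => mn; rewrite um.
by move=> [_ /negP]; rewrite negbK => /eqP ->; rewrite scale0r.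
Qed.

Lemma comb_linear q : linear (comb q).
Proof.
move=> a u v; have [mu hu] := l2fin_bound u; have [mv hv] := l2fin_bound v.
have hu' n : (maxn mu mv <= n)%N -> u n = 0 by rewrite geq_max => /andP[/hu].
have hv' n : (maxn mu mv <= n)%N -> v n = 0.
  by rewrite geq_max => /andP[_ /hv].
rewrite (comb_bound _ hu') (comb_bound _ hv') (@comb_bound _ _ (maxn mu mv)).
  rewrite scaler_sumr -big_split; apply: eq_bigr => i _ /=.
  by rewrite l2finD l2finZ scalerDl scalerA.
move=> n h; rewrite l2finD l2finZ.
by rewrite hu' ?hv' ?mulr0 ?addr0.
Qed.

HB.instance Definition _ q := GRing.isLinear.Build R[i] (l2fin R) {poly R[i]}
  *:%R (comb q) (comb_linear q).

Lemma combZ q a u : comb q (a *: u) = a *: comb q u.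
Proof. exact: linearZ_LR. Qed.

Lemma comb_l2e q n : comb q (l2e R n) = q n.
Proof.
rewrite (@comb_bound _ _ n.+1) => [|k]; last by rewrite l2eE => /gtn_eqF ->.
rewrite big_ord_recr /= l2eE eqxx scale1r big1 ?add0r// => i _.
by rewrite l2eE ltn_eqF ?scale0r.
Qed.

Hypothesis (q : nat -> {poly R[i]}) (sq : forall n, size (q n) = n.+1).

Lemma comb_inj : injective (comb q).
Proof.
move=> u v cuv; have uv : comb q (u - v) = 0 by rewrite raddfB /= cuv subrr.
apply/l2fin_eqP => n; apply/eqP; rewrite -subr_eq0; apply/eqP.
have [m hm] := l2fin_bound (u - v).
rewrite (comb_bound _ hm) in uv.
have [/hm//|nm] := leqP m n; exact: (polys_free sq uv).
Qed.

Lemma comb_span (f : {poly R[i]}) (m : nat) : (size f <= m)%N ->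
  exists2 u, comb q u = f & forall n, (m <= n)%N -> u n = 0.
Proof.
move=> /(polys_span sq)[c ->]; exists (\sum_(n < m) c n *: l2e R n).
  rewrite linear_sum; apply: eq_bigr => i _.
  by rewrite /= combZ comb_l2e.
by move=> n mn; rewrite l2fin_sum_l2e ltnNge mn.
Qed.

End comb.

(** * Integration of complex polynomials against [sigma] *)

Section integral.
Variable (R : realType).
Variable sigma : {finite_measure set (measurableTypeR R) -> \bar R}.
Implicit Types (f g : {poly R[i]}).
Notation L0 := {mfun_ sigma, measurableTypeR R >-> R[i]}.

(** The Borel sets of [R[i]] are transported from the product, where the real part is the first
    projection. *)
Lemma measurable_Re (h : measurableTypeR R -> R[i]) :
  measurable_fun setT h -> measurable_fun setT (fun x => complex.Re (h x) : R).
Proof.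
move=> mh _ B mB; rewrite setTI.
have /(mh measurableT) : measurable [set z : R[i] | B (complex.Re z)].
  have := @measurable_fst _ _ (measurableTypeR R) (measurableTypeR R)
    measurableT B mB.
  by rewrite setTI.
by rewrite setTI.
Qed.

Lemma measurable_Im (h : measurableTypeR R -> R[i]) :
  measurable_fun setT h -> measurable_fun setT (fun x => complex.Im (h x) : R).
Proof.
move=> mh _ B mB; rewrite setTI.
have /(mh measurableT) : measurable [set z : R[i] | B (complex.Im z)].
  have := @measurable_snd _ _ (measurableTypeR R) (measurableTypeR R)
    measurableT B mB.
  by rewrite setTI.
by rewrite setTI.
Qed.

Lemma measurable_L0 (h : L0) : measurable_fun setT (h : measurableTypeR R -> R[i]).
Proof. exact: measurable_funP. Qed.

Lemma poly_class_ae f :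
  {ae sigma, forall x, poly_class sigma f x = poly_fun f x}.
Proof.
have /eqmodP : (repr (poly_class sigma f) = poly_fun f %[mod L0])%qT.
  by rewrite reprK.
by move=> /asboolP; apply: filterS => x /(_ I).
Qed.

Definition complex_integrable (h : measurableTypeR R -> R[i]) :=
  sigma.-integrable setT (fun x => (complex.Re (h x))%:E) /\
  sigma.-integrable setT (fun x => (complex.Im (h x))%:E).

Definition poly_integral f : R[i] :=
  (\int[sigma]_x complex.Re (poly_fun f x)) +i*
  (\int[sigma]_x complex.Im (poly_fun f x)).

Lemma complex_integrable_poly_fun0 : complex_integrable (poly_fun 0).
Proof.
by split; apply: (eq_integrable measurableT _ _ _ (integrable0 sigma setT)) => // x _;
  rewrite /poly_fun horner0.
Qed.

Lemma complex_integrable_linear (a : R[i]) f g :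
  complex_integrable (poly_fun f) -> complex_integrable (poly_fun g) ->
  complex_integrable (poly_fun (a *: f + g)).
Proof.
move=> [rf mf] [rg mg]; case: a => a b; split.
- apply: (eq_integrable measurableT _ _ _ (integrableD measurableT (integrableB measurableT
    (integrableZl measurableT a rf) (integrableZl measurableT b mf)) rg)) => // x _.
  rewrite /poly_fun hornerD hornerZ /=.
  by case: f.[_] => u v; case: g.[_].
- apply: (eq_integrable measurableT _ _ _ (integrableD measurableT (integrableD measurableT
    (integrableZl measurableT a mf) (integrableZl measurableT b rf)) mg)) => // x _.
  rewrite /poly_fun hornerD hornerZ /=.
  by case: f.[_] => u v; case: g.[_].
Qed.

Lemma poly_integral_linear (a : R[i]) f g :
  complex_integrable (poly_fun f) -> complex_integrable (poly_fun g) ->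
  poly_integral (a *: f + g) = a * poly_integral f + poly_integral g.
Proof.
move=> [rf mf] [rg mg]; case: a => a b.
have ZR c : sigma.-integrable setT
    (EFin \o (fun x => c * complex.Re (poly_fun f x))).
  exact: (integrableZl measurableT c rf).
have ZI c : sigma.-integrable setT
    (EFin \o (fun x => c * complex.Im (poly_fun f x))).
  exact: (integrableZl measurableT c mf).
apply/eqP; rewrite eq_complex /=; apply/andP; split; apply/eqP.
- rewrite -!RintegralZl// -RintegralB//.
  rewrite -RintegralD//; last exact: (integrableB measurableT (ZR a) (ZI b)).
  apply: eq_Rintegral => x _.
  rewrite /poly_fun hornerD hornerZ /=.
  by case: f.[_] => u v; case: g.[_].
- rewrite -!RintegralZl// -RintegralD//.
  rewrite -RintegralD//; last exact: (integrableD measurableT (ZI a) (ZR b)).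
  apply: eq_Rintegral => x _.
  rewrite /poly_fun hornerD hornerZ /=.
  by case: f.[_] => u v; case: g.[_].
Qed.

Lemma measurable_mul_conj (h k : measurableTypeR R -> R[i]) :
  measurable_fun setT h -> measurable_fun setT k ->
  measurable_fun setT (fun x => h x * (k x)^*).
Proof.
move=> mh mk; have mrh := measurable_Re mh; have mih := measurable_Im mh.
have mrk := measurable_Re mk; have mik := measurable_Im mk.
have E x : h x * (k x)^* =
    (complex.Re (h x) * complex.Re (k x) + complex.Im (h x) * complex.Im (k x))
    +i* (complex.Im (h x) * complex.Re (k x) - complex.Re (h x) * complex.Im (k x)).
  case: (h x) (k x) => a b [u v] /=; apply/eqP; rewrite eq_complex /=.
  by rewrite !mulrN opprK addrC [_ + b * u]addrC !eqxx.
apply: measurable_complex_fun.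
- under eq_fun do rewrite E /=.
  by apply: measurable_funD; apply: measurable_funM.
- under eq_fun do rewrite E /=.
  by apply: measurable_funB; apply: measurable_funM.
Qed.

Lemma poly_fun_conj f x : poly_fun (map_poly conjc f) x = (poly_fun f x)^*.
Proof.
rewrite /poly_fun -[in RHS]horner_map; congr (_.[_]).
by apply/eqP; rewrite eq_complex /= oppr0 !eqxx.
Qed.

(** [L2inner] integrates chosen representatives, which agree with the polynomials almost everywhere.
    At real points, conjugating the value amounts to conjugating the coefficients, so the integrand
    becomes a single polynomial. *)
Lemma L2inner_poly_class f g :
  L2inner (poly_class sigma f) (poly_class sigma g) =
  poly_integral (f * map_poly conjc g).
Proof.
have fgE : {ae sigma, forall x, poly_class sigma f x * (poly_class sigma g x)^* =
    poly_fun (f * map_poly conjc g) x}.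
  apply: filterS2 (poly_class_ae f) (poly_class_ae g) => x -> ->.
  by rewrite [RHS]hornerM; congr (_ * _); rewrite [RHS]poly_fun_conj.
have mfg := measurable_mul_conj (measurable_L0 (poly_class sigma f))
  (measurable_L0 (poly_class sigma g)).
have mq := measurable_poly_fun (f * map_poly conjc g).
rewrite /L2inner /poly_integral /Rintegral; congr (fine _ +i* fine _).
- apply: ae_eq_integral => //.
  + by have /measurable_EFinP := measurable_Re mfg.
  + by have /measurable_EFinP := measurable_Re mq.
  + by apply: filterS fgE => x /= -> _.
- apply: ae_eq_integral => //.
  + by have /measurable_EFinP := measurable_Im mfg.
  + by have /measurable_EFinP := measurable_Im mq.
  + by apply: filterS fgE => x /= -> _.
Qed.

End integral.

(** * Isometry between finitely supported vectors and polynomials *)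

Lemma normr_le_1Dsqr (F : realFieldType) (y : F) : `|y| <= 1 + y ^+ 2.
Proof. by rewrite ler_norml; apply/andP; split; nra. Qed.

Section isometry.
Variables (R : realType).
Variable sigma : {finite_measure set (measurableTypeR R) -> \bar R}.
Variable r : nat -> {poly R}.
Hypothesis sr : forall n, size (r n) = n.+1.
Hypothesis orth : orthonormal_polynomials sigma r.

Notation rC := (fun n => complex_poly (r n)).

Lemma size_complex_poly (q : {poly R}) : size (complex_poly q) = size q.
Proof. exact: size_map_poly. Qed.

Lemma poly_fun_complex_poly (q : {poly R}) (x : R) :
  poly_fun (complex_poly q) x = (q.[x])%:C.
Proof. exact: horner_map. Qed.

(** For a finite measure, square integrability implies integrability, since [1 + q^2] dominates
    [|q|]. *)
Lemma complex_integrable_L2 (q : {poly R}) :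
  L2 (poly_class sigma (complex_poly q)) ->
  complex_integrable sigma (poly_fun (complex_poly q)).
Proof.
rewrite /L2 /=; set h := poly_class _ _ => hoo.
have mq := measurable_Re (measurable_poly_fun (complex_poly q)).
have mh := measurable_L0 h.
have normE x : Normc.normc (h x) ^+ 2 =
    complex.Re (h x) ^+ 2 + complex.Im (h x) ^+ 2.
  by case: (h x) => a b /=; rewrite sqr_sqrtr// addr_ge0 ?sqr_ge0.
have mnorm : measurable_fun setT (fun x => (Normc.normc (h x) ^+ 2)%:E).
  apply/measurable_EFinP; under eq_fun do rewrite normE.
  by apply: measurable_funD; apply: measurable_funX;
    [exact: measurable_Re|exact: measurable_Im].
have mq2 : measurable_fun setT
    (fun x => (complex.Re (poly_fun (complex_poly q) x) ^+ 2)%:E).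
  by apply/measurable_EFinP; exact: measurable_funX.
have q2 : sigma.-integrable setT
    (fun x => (complex.Re (poly_fun (complex_poly q) x) ^+ 2)%:E).
  apply/integrableP; split => //.
  under eq_integral do rewrite gee0_abs ?lee_fin ?sqr_ge0//.
  rewrite (ge0_ae_eq_integral _ mq2 mnorm)//.
  - by move=> x _; rewrite lee_fin sqr_ge0.
  - by move=> x _; rewrite lee_fin sqr_ge0.
  - apply: filterS (poly_class_ae sigma (complex_poly q)) => x /= hx _.
    by rewrite normE /h hx poly_fun_complex_poly /= expr0n addr0.
split.
  apply: (le_integrable measurableT _ _
    (integrableD measurableT (finite_measure_integrable_cst sigma 1 measurableT) q2)).
    exact/measurable_EFinP.
  move=> x _; rewrite /= lee_fin; set y := complex.Re _.
  rewrite [leRHS]ger0_norm ?addr_ge0 ?sqr_ge0//.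
  exact: normr_le_1Dsqr.
apply: (eq_integrable measurableT _ _ _ (integrable0 sigma setT)) => x _.
by rewrite poly_fun_complex_poly.
Qed.

(** Finiteness of the moments of [sigma] comes from [orth]: the [r n] are integrable because they
    lie in [L2], and they span all polynomials. *)
Lemma complex_integrable_poly (f : {poly R[i]}) :
  complex_integrable sigma (poly_fun f).
Proof.
have [n|c ->] := @polys_span _ rC _ f _ (leqnn _).
  by rewrite size_complex_poly.
elim: (size f) => [|m IH].
  by rewrite big_ord0; exact: complex_integrable_poly_fun0.
rewrite big_ord_recr /= addrC; apply: complex_integrable_linear IH.
exact/complex_integrable_L2/(proj1 orth).
Qed.

Lemma poly_integral_sum (m : nat) (c : nat -> R[i]) (f : nat -> {poly R[i]}) :
  poly_integral sigma (\sum_(n < m) c n *: f n) =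
  \sum_(n < m) c n * poly_integral sigma (f n).
Proof.
have lin a g h : poly_integral sigma (a *: g + h) =
    a * poly_integral sigma g + poly_integral sigma h.
  by apply: poly_integral_linear; exact: complex_integrable_poly.
elim: m => [|m IH]; last first.
  by rewrite !big_ord_recr /= addrC lin IH addrC.
(* The integral of 0 vanishes by cancellation in [lin] applied to [1 *: 0 + 0]. *)
rewrite !big_ord0; apply: (addrI (poly_integral sigma 0)).
by rewrite addr0 -[X in X + _]mul1r -lin scaler0 addr0.
Qed.

(** Parseval's identity: both sums are expanded and orthonormality keeps only the diagonal terms. *)
Lemma L2inner_model_map (u v : l2fin R) (m : nat) :
  (forall n, (m <= n)%N -> u n = 0) -> (forall n, (m <= n)%N -> v n = 0) ->
  L2inner (model_map sigma r u) (model_map sigma r v) =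
  \sum_(n < m) u n * (v n)^*.
Proof.
move=> um vm; rewrite L2inner_poly_class.
have -> : \sum_(n \in [set n | u n != 0]) u n *: complex_poly (r n) =
    \sum_(n < m) u n *: rC n := @comb_bound _ rC _ _ um.
have -> : \sum_(n \in [set n | v n != 0]) v n *: complex_poly (r n) =
    \sum_(n < m) v n *: rC n := @comb_bound _ rC _ _ vm.
rewrite mulr_suml; under eq_bigr do rewrite -scalerAl.
rewrite (poly_integral_sum m u (fun n => rC n * _)).
apply: eq_bigr => n _; congr (_ * _).
have -> : map_poly conjc (\sum_(n < m) v n *: rC n) =
    \sum_(n < m) (v n)^* *: map_poly conjc (rC n).
  by rewrite rmorph_sum; apply: eq_bigr => i _; rewrite /= map_polyZ.
rewrite mulr_sumr; under eq_bigr do rewrite -scalerAr.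
rewrite (poly_integral_sum m (fun l => (v l)^*)
  (fun l => rC n * map_poly conjc (rC l))).
under eq_bigr do rewrite -L2inner_poly_class (proj2 orth).
rewrite (bigD1 n)//= eqxx mulr1 big1 ?addr0// => l.
by rewrite eq_sym => /negbTE; rewrite -val_eqE /= => ->; rewrite mulr0.
Qed.

End isometry.

(** * Degrees and signs of leading coefficients *)

Section degrees.
Variable R : realFieldType.
Implicit Types (f g h : {poly R}).

(** Stated with a size bound, which is easy to propagate through sums; positivity then forces the
    exact size. *)
Definition pos_degree n f := (size f <= n.+1)%N && (0 < f`_n).

Lemma size_pos_degree n f : pos_degree n f -> size f = n.+1.
Proof.
move=> /andP[fn fn0]; apply/eqP; rewrite eqn_leq fn /= ltnNge.
by apply: contraTN fn0 => /leq_sizeP/(_ n (leqnn n)) ->; rewrite ltxx.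
Qed.

Lemma size_sum_graded (q : nat -> {poly R}) (c : nat -> R) (m : nat) :
  (forall j, (j < m)%N -> size (q j) = j.+1) ->
  (size (\sum_(j < m) c j *: q j)%R <= m)%N.
Proof.
move=> sq; apply/leq_sizeP => l ml; rewrite coef_sum big1// => i _.
by rewrite coefZ nth_default ?mulr0// sq// (leq_trans (ltn_ord i)).
Qed.

Lemma pos_degree_sum (q : nat -> {poly R}) (c : nat -> R) (m : nat) :
  (forall j, (j <= m)%N -> pos_degree j (q j)) -> 0 < c m ->
  pos_degree m (\sum_(j < m.+1) c j *: q j).
Proof.
move=> pq c0; have sq j : (j <= m)%N -> size (q j) = j.+1.
  by move=> /pq/size_pos_degree.
apply/andP; split; first exact: size_sum_graded.
rewrite big_ord_recr /= coefD nth_default ?add0r; last first.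
  by apply: size_sum_graded => j /ltnW; exact: sq.
by rewrite coefZ mulr_gt0//; have /andP[] := pq m (leqnn m).
Qed.

Lemma pos_degreeXM n f : pos_degree n f -> pos_degree n.+1 ('X * f).
Proof.
move=> pf; have /andP[_ f0] := pf; apply/andP; split; last by rewrite coefXM.
by rewrite mulrC (leq_trans (size_polyMleq _ _))// size_polyX (size_pos_degree pf)
  addn2.
Qed.

(** One step of a recurrence solved for its newest term [f]: [h] gathers earlier polynomials, of
    degree too low to affect the coefficient of [X^n]. *)
Lemma pos_degree_step (c : R) n f g h : 0 < c -> c *: f = g - h ->
  pos_degree n g -> (size h <= n)%N -> pos_degree n f.
Proof.
move=> c0 cf /andP[sg g0] sh; have -> : f = c^-1 *: (g - h).
  by rewrite -cf scalerA mulVf ?scale1r// gt_eqF.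
apply/andP; split.
  rewrite (leq_trans (size_scale_leq _ _))// (leq_trans (size_polyD _ _))//.
  by rewrite size_polyN geq_max sg leqW.
by rewrite coefZ coefB [h`_n]nth_default// subr0 mulr_gt0// invr_gt0.
Qed.

End degrees.

(** * The polynomials and the associated operator of a pencil *)

Section pencil.
Variables (R : realType) (T : jacobi_pencil R).

Lemma J3_far k : J3 T k k.+2 = 0.
Proof. by apply: J3_band; rewrite add1n ltnSn. Qed.

(** Row [k] of the pencil equation determines [p k.+2], through the positive entry [J5 T k k.+2],
    from ['X] times row [k] of [J3] applied to [p], which has degree [k + 2] because [J3 T k k.+1]
    is positive. *)
Lemma associated_pos_degree p n :
  associated_polynomials T p -> pos_degree n (p n).
Proof.
move=> [p0 p1 pk]; have [m] := ubnP n.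
elim: m n => // m IH [|[|k]] nm.
- by rewrite p0 /pos_degree size_poly1 coefC /= ltr01.
- rewrite p1 /pos_degree coefD coefZ coefX coefC /= mulr1 addr0 alpha_gt0 andbT.
  rewrite (leq_trans (size_polyD _ _))// geq_max.
  by rewrite (leq_trans (size_scale_leq _ _)) ?size_polyX// (leq_trans (size_polyC_leq1 _)).
have pj j : (j <= k.+1)%N -> pos_degree j (p j).
  by move=> jk; apply: IH; rewrite (leq_ltn_trans jk).
have := pk k; rewrite /mulmx_polys big_ord_recr [X in 'X * X]big_ord_recr /=.
(* The truncated row formally includes column [k + 2], where [J3] is zero. *)
rewrite J3_far scale0r addr0 => /eqP; rewrite subr_eq0 eq_sym addrC -subr_eq.
rewrite eq_sym => /eqP pE; apply: (pos_degree_step (J5_gt0 T k) pE).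
  by apply/pos_degreeXM/pos_degree_sum => //; exact: J3_gt0.
by apply: size_sum_graded => j jk; apply/size_pos_degree/pj.
Qed.

Lemma jacobi_pos_degree r n : jacobi_polynomials T r -> pos_degree n (r n).
Proof.
move=> [r0 rk]; have [m] := ubnP n.
elim: m n => // m IH [|k] nm.
- by rewrite r0 /pos_degree size_poly1 coefC /= ltr01.
have rj j : (j <= k)%N -> pos_degree j (r j).
  by move=> jk; apply: IH; rewrite (leq_ltn_trans jk).
have := rk k; rewrite /mulmx_polys big_ord_recr /= J3_far scale0r addr0.
rewrite big_ord_recr /= => /eqP; rewrite eq_sym addrC -subr_eq eq_sym => /eqP rE.
apply: (pos_degree_step (J3_gt0 T k) rE); first exact/pos_degreeXM/rj.
by apply: size_sum_graded => j jk; apply/size_pos_degree/rj.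
Qed.

(** Triangular elimination: column [m] of [J3] ends in row [m + 1] with a positive entry, so a
    multiple of it clears the last coordinate of [u]. *)
Lemma J3e_span (m : nat) (u : l2fin R) : (forall n, (m < n)%N -> u n = 0) ->
  exists (zeta : R[i]) (xi : nat -> R[i]), u = zeta *: l2e R 0 + \sum_(n < m) xi n *: J3e T n.
Proof.
elim: m u => [u um|m IH u um].
  exists (u 0%N), (fun=> 0); rewrite big_ord0 addr0; apply: l2fin_eqP => n.
  rewrite l2finZ l2eE; case: n => [|n]; first by rewrite mulr1.
  by rewrite um ?mulr0.
have J0 : (J3 T m m.+1)%:C != 0 by rewrite fmorph_eq0 gt_eqF// J3_gt0.
pose c := u m.+1 / (J3 T m m.+1)%:C.
have [n mn|zeta [xi uE]] := IH (u - c *: J3e T m).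
  have -> : (u - c *: J3e T m) n = u n - c * (J3 T n m)%:C by [].
  move: mn; rewrite leq_eqVlt => /predU1P[<-|mn].
    by rewrite J3_sym divfK ?subrr.
  by rewrite um// J3_band ?mulr0 ?subr0// add1n mn orbT.
exists zeta, (fun n => if n == m then c else xi n).
rewrite big_ord_recr /= eqxx -[LHS](subrK (c *: J3e T m)) uE addrA.
by congr (_ + _ + _); apply: eq_bigr => i _; rewrite ltn_eqF.
Qed.

(** Symmetry turns the column into a row, and [w <= 2] makes the truncated sum in [mulmx_polys]
    complete. *)
Lemma comb_column (w n : nat) (J : nat -> nat -> R) (bJ : banded w J)
    (q : nat -> {poly R}) : (w <= 2)%N -> symmetric_matrix J ->
  comb (fun n => complex_poly (q n)) (L2fin (column_finite_support n bJ)) =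
  complex_poly (mulmx_polys J q n).
Proof.
move=> w2 sJ; rewrite (@comb_bound _ _ _ n.+3) => [|k nk].
  rewrite /mulmx_polys /complex_poly rmorph_sum; apply: eq_bigr => i _ /=.
  by rewrite map_polyZ sJ.
suff JE : J k n = 0 by congr (_ +i* _).
by apply: bJ; rewrite orbC (leq_ltn_trans _ nk)// -addn2 addnC leq_add2l.
Qed.

Variables (p : nat -> {poly R}) (A : l2fin R -> l2fin R).
Hypothesis hp : associated_polynomials T p.
Hypothesis hA : associated_operator T A.
Notation pC := (fun n => complex_poly (p n)).

(** It suffices to treat the vectors on which [A] is prescribed. For [e_0], the image
    [(p_1 - beta) / alpha] is ['X]; for [J3 e_n], the claim is row [n] of the pencil equation. *)
Lemma comb_associated_operator u : comb pC (A u) = 'X * comb pC u.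
Proof.
have [m hm] := l2fin_bound u.
have [n mn|zeta [xi ->]] := @J3e_span m u; first by rewrite hm// ltnW.
have [p0 p1 pk] := hp.
rewrite hA !raddfD /= !combZ raddfN /= combZ !comb_l2e p0 p1 -scalerDr.
rewrite mulrDr; congr (_ + _).
  rewrite /complex_poly rmorphD /= map_polyZ map_polyX map_polyC rmorph1 /=.
  rewrite alg_polyC addrK scalerA divfK ?fmorph_eq0 ?gt_eqF ?alpha_gt0//.
  by rewrite -scalerAr mulr1.
rewrite !linear_sum mulr_sumr; apply: eq_bigr => i _.
rewrite /= !combZ -scalerAr; congr (_ *: _).
rewrite (comb_column _ _ _ (leqnn 2) (@J5_sym _ T)) (comb_column _ _ _ (leqnSn 1) (@J3_sym _ T)).
have /eqP := pk i; rewrite subr_eq0 => /eqP ->.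
by rewrite /complex_poly rmorphM /= map_polyX.
Qed.

Lemma comb_iter_associated_operator N u :
  comb pC (iter N A u) = 'X^N * comb pC u.
Proof.
elim: N => [|N IH]; first by rewrite expr0 mul1r.
by rewrite iterS comb_associated_operator IH mulrA exprS.
Qed.

End pencil.

(** * The matrix of an operator acting as multiplication by [X^N] *)

Lemma conj_l2e (R : realType) (n k : nat) :
  ((l2e R n k)^*)%R = (k == n)%:R.
Proof. by rewrite l2eE rmorph_nat. Qed.

Section matrix.
Variables (R : realType) (P : nat -> {poly R[i]}) (B : l2fin R -> l2fin R).
Variable N : nat.
Hypothesis sP : forall n, size (P n) = n.+1.
Hypothesis BP : forall u, comb P (B u) = 'X^N * comb P u.

Definition op_entry l k : R[i] := B (l2e R k) l.

Lemma comb_op_entry k :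
  'X^N * P k = \sum_(l < (k + N).+1) op_entry l k *: P l.
Proof.
have [|u uP u0] := @comb_span _ _ sP ('X^N * P k) (k + N).+1.
  by rewrite (leq_trans (size_polyMleq _ _))// size_polyXn sP addSn addnC addSn.
have Bu : B (l2e R k) = u.
  by apply: (comb_inj sP); rewrite uP BP comb_l2e.
by rewrite -uP (comb_bound P u0) /op_entry Bu.
Qed.

(** Injectivity of [comb P] makes the expansion unique. Values of [c] beyond [k + N] are arbitrary,
    hence the test. *)
Lemma op_entry_uniq k (c : nat -> R[i]) :
  'X^N * P k = \sum_(l < (k + N).+1) c l *: P l ->
  forall l, op_entry l k = if (l <= k + N)%N then c l else 0.
Proof.
move=> cP l; rewrite /op_entry.
suff -> : B (l2e R k) = \sum_(l < (k + N).+1) c l *: l2e R l.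
  by rewrite l2fin_sum_l2e ltnS.
apply: (comb_inj sP); rewrite BP comb_l2e cP linear_sum; apply: eq_bigr => i _.
by rewrite /= combZ comb_l2e.
Qed.

Lemma op_entry_far k l : (k + N < l)%N -> op_entry l k = 0.
Proof. by move=> kl; rewrite (op_entry_uniq (comb_op_entry k)) leqNgt kl. Qed.

(** Linearity of [B] is not assumed: it follows from that of multiplication by ['X^N], as [comb P]
    is injective. *)
Lemma op_entryE (u : l2fin R) (m l : nat) : (forall n, (m <= n)%N -> u n = 0) ->
  B u l = \sum_(k < m) u k * op_entry l k.
Proof.
move=> um; suff -> : B u = \sum_(k < m) u k *: B (l2e R k).
  by rewrite l2fin_sumE; apply: eq_bigr.
apply: (comb_inj sP); rewrite BP (comb_bound P um) linear_sum mulr_sumr.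
by apply: eq_bigr => k _; rewrite /= combZ BP comb_l2e scalerAr.
Qed.

Definition hermitian := forall k l, op_entry l k = ((op_entry k l)^*)%R.

(** Since [m] bounds all four supports, the finite sums are full inner products. *)
Lemma hermitianP :
  hermitian <-> forall (u v : l2fin R) m,
    (forall n, (m <= n)%N -> [/\ u n = 0, v n = 0, B u n = 0 & B v n = 0]) ->
    \sum_(n < m) B u n * (v n)^* = \sum_(n < m) u n * (B v n)^*.
Proof.
split=> [herm u v m uvm|sym k l].
  have um n : (m <= n)%N -> u n = 0 by move=> /uvm[].
  have vm n : (m <= n)%N -> v n = 0 by move=> /uvm[].
  under eq_bigr do rewrite (op_entryE _ um) mulr_suml.
  rewrite exchange_big; apply: eq_bigr => k _ /=.
  rewrite (op_entryE _ vm) rmorph_sum mulr_sumr; apply: eq_bigr => n _ /=.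
  by rewrite herm rmorphM -mulrA [X in _ * X]mulrC.
have [mk hk] := l2fin_bound (B (l2e R k)).
have [ml hl] := l2fin_bound (B (l2e R l)).
pose m := maxn (maxn k.+1 l.+1) (maxn mk ml).
have km : (k < m)%N by rewrite !leq_max leqnn.
have lm : (l < m)%N by rewrite !leq_max leqnn orbT.
have ekm j n : (j < m)%N -> (m <= n)%N -> l2e R j n = 0.
  by move=> jm mn; rewrite l2eE gtn_eqF// (leq_trans jm).
(* On basis vectors each sum reduces to one term: [op_entry l k] on the left, the conjugate of
   [op_entry k l] on the right. *)
have := sym (l2e R k) (l2e R l) m.
rewrite (bigD1 (Ordinal lm))//= conj_l2e eqxx mulr1 [X in _ + X = _]big1.
  rewrite addr0 (bigD1 (Ordinal km))//= l2eE eqxx mul1r [X in _ + X]big1.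
    rewrite addr0; apply=> n mn; split; [exact: ekm|exact: ekm|apply: hk|apply: hl].
      by rewrite (leq_trans _ mn)// !leq_max leqnn !orbT.
    by rewrite (leq_trans _ mn)// !leq_max leqnn !orbT.
  by move=> i; rewrite -val_eqE /= l2eE => /negbTE ->; rewrite mul0r.
by move=> i; rewrite -val_eqE /= conj_l2e => /negbTE ->; rewrite mulr0.
Qed.

(** Only the last term of the expansion of ['X^N * P k] reaches degree [k + N]. *)
Lemma lead_op_entry k :
  op_entry (k + N) k * lead_coef (P (k + N)) = lead_coef (P k).
Proof.
have /(congr1 (fun f : {poly R[i]} => f`_(k + N))) := comb_op_entry k.
rewrite coefXnM ltnNge leq_addl /= addnK big_ord_recr /= coefD coefZ coef_sum big1.
  by rewrite add0r !lead_coefE !sP => ->.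
by move=> i _; rewrite coefZ nth_default ?mulr0// sP.
Qed.

Lemma recurrence_hermitian (a : nat -> nat -> R[i]) :
  (forall m, a m 0%N \is Num.real) ->
  (forall k, \sum_(1 <= j < N.+1)
      ((if (j <= k)%N then (a (k - j)%N j)^* *: P (k - j)%N else 0)
       + a k j *: P (k + j)%N) + a k 0%N *: P k = 'X^N * P k) ->
  hermitian.
Proof.
move=> a0 aP.
(* The matrix prescribed by the recurrence: [a k j] lies [j] rows below the diagonal in column [k],
   its conjugate in the mirror position. Since [a k j] is unconstrained for [j > N], the band is cut
   off explicitly. *)
pose G l k := if (l < k)%N then (if (k <= l + N)%N then (a l (k - l)%N)^* else 0)
  else a k (l - k)%N.
have entryE k l : op_entry l k = if (l <= k + N)%N then G l k else 0.
  apply: (op_entry_uniq (c := G^~ k)).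
  rewrite -aP (@big_band_split _ (fun l => G l k *: P l)) => [|l' lk]; last first.
    by rewrite /G ifT ?ifF ?scale0r//; lia.
  congr (_ + _); last by rewrite /G ltnn subnn.
  rewrite !big_nat; apply: eq_bigr => j /andP[j0 jN]; congr (_ + _).
    by case: leqP => // jk; rewrite /G subKn// ltn_subrL j0 ifT ?ifT//; lia.
  by rewrite /G ifF ?addKn//; lia.
have lt_herm k l : (l < k)%N -> op_entry l k = ((op_entry k l)^*)%R.
  move=> lk; rewrite !entryE /G lk ltnNge (ltnW lk) /=.
  by rewrite (leq_trans (ltnW lk)) ?leq_addr//; case: ifP => // _; rewrite conjC0.
move=> k l; have [lk|kl|->] := ltngtP l k; first exact: lt_herm.
  by rewrite (lt_herm _ _ kl) conjCK.
by rewrite entryE leq_addr /G ltnn subnn conj_Creal.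
Qed.

Lemma hermitian_recurrence : hermitian ->
  (forall n, 0 < lead_coef (P n)) ->
  exists a : nat -> nat -> R[i],
  [/\ forall m, 0 < a m N,
      forall m, a m 0%N \is Num.real &
      forall k, \sum_(1 <= j < N.+1)
        ((if (j <= k)%N then (a (k - j)%N j)^* *: P (k - j)%N else 0)
         + a k j *: P (k + j)%N) + a k 0%N *: P k = 'X^N * P k].
Proof.
(* The coefficients are read on and below the diagonal; hermitian symmetry supplies the conjugates
   above it. *)
move=> herm lP; exists (fun m j => op_entry (m + j) m); split=> [m|m|k].
- by rewrite -(pmulr_lgt0 _ (lP (m + N)%N)) lead_op_entry.
- by rewrite addn0; apply/CrealP; rewrite -[RHS]conjCK -herm.
rewrite comb_op_entry (@big_band_split _ (fun l => op_entry l k *: P l)) => [|l lk].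
  rewrite addn0; congr (_ + _); apply: eq_bigr => j _; congr (_ + _).
  by case: leqP => // jk; rewrite subnK// -herm.
(* Degrees bound the band only from below; its upper edge comes from symmetry. *)
by rewrite herm op_entry_far// conjC0 scale0r.
Qed.

End matrix.


(** * The model operator on polynomial classes *)

Section model.
Variables (R : realType).
Variable sigma : {finite_measure set (measurableTypeR R) -> \bar R}.
Variable r : nat -> {poly R}.
Hypothesis sr : forall n, size (r n) = n.+1.
Hypothesis orth : orthonormal_polynomials sigma r.

(** Linear independence of the [r n] as polynomials would not suffice, as distinct polynomials may
    agree almost everywhere. Orthonormality recovers each coordinate as an inner product. *)
Lemma model_map_inj : injective (model_map sigma r).
Proof.
move=> u v uv; apply/l2fin_eqP => n.
suff coefE (w : l2fin R) m : (forall j, (m <= j)%N -> w j = 0) -> (n < m)%N -> w n =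
    L2inner (model_map sigma r w) (model_map sigma r (l2e R n)).
  have [mu hu] := l2fin_bound u; have [mv hv] := l2fin_bound v.
  rewrite (coefE u (maxn mu n.+1)) ?(coefE v (maxn mv n.+1)) ?uv// ?leq_max ?leqnn ?orbT//.
    by move=> j; rewrite geq_max => /andP[/hv].
  by move=> j; rewrite geq_max => /andP[/hu].
move=> wm nm; rewrite (L2inner_model_map sr orth wm) => [|j mj].
  rewrite (bigD1 (Ordinal nm))//= conj_l2e eqxx mulr1 big1 ?addr0// => i.
  by rewrite -val_eqE /= conj_l2e => /negbTE ->; rewrite mulr0.
by rewrite l2eE gtn_eqF// (leq_trans nm).
Qed.

(** By injectivity, the preimage chosen by [xget] is [u] itself. *)
Lemma model_representation_map A u :
  model_representation sigma r A (model_map sigma r u) = model_map sigma r (A u).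
Proof.
rewrite /model_representation; congr (model_map _ _ (A _)).
by apply: model_map_inj; apply: (xgetPex 0 (P := [set v | _ v = _])); exists u.
Qed.

Lemma iter_model_representation A N u :
  iter N (model_representation sigma r A) (model_map sigma r u) =
  model_map sigma r (iter N A u).
Proof. by elim: N => //= N ->; rewrite model_representation_map. Qed.

Lemma poly_classes_model_map f :
  poly_classes f <-> exists u, f = model_map sigma r u.
Proof.
split=> [[q _ <-]|[u ->]]; last by eexists.
have [n|u <- _] := @comb_span _ (fun n => complex_poly (r n)) _ q _ (leqnn _).
  by rewrite size_complex_poly.
by exists u.
Qed.

Lemma symmetric_model_representation A N :
  symmetric_on_polynomials (iter N (model_representation sigma r A)) <->
  forall (u v : l2fin R) m,
    (forall n, (m <= n)%N ->
       [/\ u n = 0, v n = 0, iter N A u n = 0 & iter N A v n = 0]) ->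
    \sum_(n < m) iter N A u n * (v n)^* = \sum_(n < m) u n * (iter N A v n)^*.
Proof.
split=> [sym u v m uvm|sym f g].
  rewrite -!(L2inner_model_map sr orth); try by move=> n /uvm[].
  rewrite -!iter_model_representation; apply: sym.
    by apply/poly_classes_model_map; exists u.
  by apply/poly_classes_model_map; exists v.
move=> /poly_classes_model_map[u ->] /poly_classes_model_map[v ->].
rewrite !iter_model_representation.
have [m1 h1] := l2fin_bound u; have [m2 h2] := l2fin_bound v.
have [m3 h3] := l2fin_bound (iter N A u).
have [m4 h4] := l2fin_bound (iter N A v).
pose m := maxn (maxn m1 m2) (maxn m3 m4).
have uvm n : (m <= n)%N ->
    [/\ u n = 0, v n = 0, iter N A u n = 0 & iter N A v n = 0].
  rewrite !geq_max => /andP[/andP[/h1 ? /h2 ?] /andP[/h3 ? /h4 ?]].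
  by split.
rewrite !(L2inner_model_map sr orth (m := m)); try by move=> n /uvm[].
exact: sym.
Qed.

End model.

Unset Implicit Arguments.

Theorem theorem7 (R : realType) (Theta : jacobi_pencil R)
  (p : nat -> {poly R}) (hp : associated_polynomials Theta p)
  (A : l2fin R -> l2fin R) (hA : associated_operator Theta A)
  (r : nat -> {poly R}) (hr : jacobi_polynomials Theta r)
  (sigma : {finite_measure set (measurableTypeR R) -> \bar R})
  (hsigma : orthonormal_polynomials sigma r)
  (N : nat) (hN : (0 < N)%N) :
  (exists a : nat -> nat -> R[i],
      [/\ forall m, 0 < a m N,
          forall m, a m 0%N \is Num.real &
          forall k,
            \sum_(1 <= j < N.+1)
               ((if (j <= k)%N
                 then (a (k - j)%N j)^* *: complex_poly (p (k - j)%N) else 0)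
                + a k j *: complex_poly (p (k + j)%N))
            + a k 0%N *: complex_poly (p k)
            = 'X^N * complex_poly (p k)])
  <-> symmetric_on_polynomials (iter N (model_representation sigma r A)).
Proof.
have sp n : size (complex_poly (p n)) = n.+1.
  by rewrite size_complex_poly (size_pos_degree (associated_pos_degree n hp)).
have sr n : size (r n) = n.+1 by apply/size_pos_degree/(jacobi_pos_degree n hr).
(* Two bases are at work: the isometry given by [r] moves symmetry to vectors, then the expansion in
   [p] identifies the matrix with the recurrence coefficients. *)
rewrite (symmetric_model_representation sr hsigma).
have BP := comb_iter_associated_operator hp hA N.
rewrite -(hermitianP sp BP); split=> [[a [_ a0 aP]]|herm].
  exact: (recurrence_hermitian sp BP a0 aP).
apply: (hermitian_recurrence sp BP herm) => n.
have := associated_pos_degree n hp => pn; have /andP[_ pn0] := pn.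
by rewrite lead_coef_map lead_coefE (size_pos_degree pn) ltcR.
Qed.
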